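(* Let $1\le k\le n$ and let $t$ be an integer with $0\le t\le (k-1)(n-k)$ (the number of $-1$ entries of $F_n^k$). Then there exist an $n\times n$ ASM $A_k$ with exactly $t$ entries equal to $-1$ and $n\times n$ permutation matrices $P_1,\ldots,P_{k-1},P_{k+1},\ldots,P_n$ such that $[P_1,\ldots,P_{k-1},A_k,P_{k+1},\ldots,P_n]$ is an $n\times n\times n$ ASHM.
   Context: An $n\times n$ alternating sign matrix (ASM) is an $n\times n$ matrix with entries in $\{0,1,-1\}$ such that in every row and column the nonzeros alternate in sign, beginning and ending with $+1$. An $n\times n\times n$ hypermatrix $[A_1,\ldots,A_n]$ ($A_s$ the horizontal planes) is an ASHM if all entries are in $\{0,\pm1\}$ and in every line (obtained by fixing two of the three indices) the nonzeros alternate in sign beginning and ending with $+1$. For $1\le k\le n$, $F_n^k=[f_{ij}]$ is the $n\times n$ matrix with $f_{ij}=(-1)^{i+j+k+1}$ if $k+1\le i+j\le 2n+1-k$ and $|i-j|\le k-1$, and $f_{ij}=0$ otherwise; it is an ASM with $(k-1)(n-k)$ entries equal to $-1$. *)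

(* Defs.v *)
From HB Require Import structures.
From mathcomp Require Import all_boot all_order all_algebra all_fingroup.
Set Implicit Arguments. Unset Strict Implicit. Unset Printing Implicit Defensive.
Import Order.TTheory GRing.Theory Num.Theory.
Local Open Scope ring_scope.

(* A finite sequence of integers is alternating-sign: all entries lie in
   {0,1,-1} and the nonzero entries read 1,-1,1,...,-1,1 (alternate in sign,
   begin and end with +1; in particular at least one nonzero entry). *)
Definition alt_sign_seq (s : seq int) : bool :=
  let nz := [seq x <- s | x != 0] in
  [&& all (fun x => x \in [:: 0; 1; -1]) s,
      nz == [seq (-1) ^+ i | i <- iota 0 (size nz)] &
      odd (size nz)].

Definition line (n : nat) (f : 'I_n -> int) : seq int :=
  [seq f i | i <- enum 'I_n].

Definition alt_line (n : nat) (f : 'I_n -> int) : bool := alt_sign_seq (line f).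

Definition is_ASM (n : nat) (A : 'M[int]_n) : Prop :=
  (forall i : 'I_n, alt_line (fun j => A i j)) /\
  (forall j : 'I_n, alt_line (fun i => A i j)).

(* Hypermatrix [A_1,...,A_n] given by its horizontal planes H s; entry
   (s,i,j) is H s i j.  ASHM: every line (fix two of the three indices)
   is alternating-sign. *)
Definition is_ASHM (n : nat) (H : 'I_n -> 'M[int]_n) : Prop :=
  (forall i j : 'I_n, alt_line (fun s => H s i j)) /\
  (forall s i : 'I_n, alt_line (fun j => H s i j)) /\
  (forall s j : 'I_n, alt_line (fun i => H s i j)).

Definition num_neg (n : nat) (A : 'M[int]_n) : nat :=
  #|[set ij : 'I_n * 'I_n | A ij.1 ij.2 == -1]|.

(* Main.v *)
Require Import Defs.
From mathcomp Require Import all_boot all_order all_algebra all_fingroup.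
From mathcomp Require Import zify.
Import Order.TTheory GRing.Theory Num.Theory.
Local Open Scope ring_scope.

(** Put [m = k - 1] and [l = n - k]. By Hall's theorem every 0/1 matrix with
    all line sums [d] is a sum of [d] permutation matrices. Hence it is
    enough to find an ASM [A] with [t] entries -1 and a 0/1 matrix [U] with
    line sums [m] such that [A + U] is again 0/1: the planes below [A] then
    decompose [U], and those above [A] decompose the complement of [A + U],
    whose line sums are [l].

    Such pairs are grown by adding a last row and a last column, which
    raises [n] and [m] by one and keeps [l]. Suppose that [A] and [U] vanish
    for [i + j >= n + m] (indices start at 0). For any [r <= l] one may
    put [r] entries -1 into [A], on the antidiagonal [i + j = n + m],
    together with [r] entries +1 on the next antidiagonal and one +1 in the
    new column. If [r = l], the new pair again vanishes for
    [i + j >= n + m + 2], so the step can be repeated. Up to reversing the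
    order of the rows, this is how [F_(n+1)^(k+1)] arises from [F_n^k].

    Given [t = q * l + r] with [q < m] and [r <= l], start from the
    antidiagonal permutation matrix and a circulant [U], do [q] steps with
    [l] new entries -1 each and a last one with [r]. *)

Set Implicit Arguments.
Unset Strict Implicit.
Unset Printing Implicit Defensive.

Section Hall.

Variables I J : finType.
Implicit Types (N : I -> {set J}) (X : {set I}).

Definition neighbours N X : {set J} := \bigcup_(x in X) N x.

Definition Hall_condition N :=
  [forall X : {set I}, #|X| <= #|neighbours N X|]%N.

Definition delete_edge N (x0 : I) (y : J) (x : I) : {set J} :=
  if x == x0 then N x :\ y else N x.

Lemma in_delete_edge N x0 y x z :
  (z \in delete_edge N x0 y x) = (z \in N x) && ((x == x0) ==> (z != y)).
Proof. by rewrite /delete_edge; case: eqP; rewrite ?inE (andbT, andbC). Qed.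

Lemma mem_neighbours_delete N x0 y X x z :
    x \in X -> z \in N x -> (x != x0) || (z != y) ->
  z \in neighbours (delete_edge N x0 y) X.
Proof.
move=> xX zN kept; apply/bigcupP; exists x => //.
by rewrite in_delete_edge zN implybE.
Qed.

Lemma Hall_violator_mem N x0 y X :
    Hall_condition N -> (#|neighbours (delete_edge N x0 y) X| < #|X|)%N ->
  x0 \in X.
Proof.
move=> /forallP/(_ X) hallX; apply: contraLR => x0X; rewrite -leqNgt.
rewrite /neighbours (eq_bigr N) // => x xX.
by rewrite /delete_edge (negPf (memPn x0X x xX)).
Qed.

(* Rado: violators [X1], [X2] of the two deletions both contain [x0], and
   submodularity would make [X1 :&: X2] without [x0] violate the condition. *)
Lemma Hall_delete_edge N x0 y1 y2 :
    Hall_condition N -> y1 != y2 ->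
  Hall_condition (delete_edge N x0 y1) || Hall_condition (delete_edge N x0 y2).
Proof.
move=> hallN y12; apply: contraT; rewrite negb_or !negb_forall.
case/andP=> /existsP[X1]; rewrite -ltnNge => viol1.
case/existsP=> X2; rewrite -ltnNge => viol2.
have x0X1 := Hall_violator_mem hallN viol1.
have x0X2 := Hall_violator_mem hallN viol2.
set B1 := neighbours _ X1 in viol1; set B2 := neighbours _ X2 in viol2.
have sub_union : neighbours N (X1 :|: X2) \subset B1 :|: B2.
  apply/bigcupsP => x /setUP xX; apply/subsetP => z zN; apply/setUP.
  have [eq_x|neq_x] := eqVneq x x0.
    have [eq_z|neq_z] := eqVneq z y1; [right|left].
      by apply: (mem_neighbours_delete _ zN); rewrite ?eq_z ?y12 ?orbT ?eq_x.
    by apply: (mem_neighbours_delete _ zN); rewrite ?neq_z ?orbT ?eq_x.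
  by case: xX => xX; [left|right];
    apply: (mem_neighbours_delete xX zN); rewrite neq_x.
have sub_inter : neighbours N ((X1 :&: X2) :\ x0) \subset B1 :&: B2.
  apply/bigcupsP => x; rewrite !inE => /and3P[neq_x xX1 xX2].
  apply/subsetP => z zN; apply/setIP.
  by split; apply: (mem_neighbours_delete _ zN); rewrite ?neq_x.
have /forallP/(_ (X1 :|: X2)) := hallN.
have /forallP/(_ ((X1 :&: X2) :\ x0)) := hallN.
move: (subset_leq_card sub_union) (subset_leq_card sub_inter).
have := cardsUI X1 X2; have := cardsUI B1 B2; have := cardsD1 x0 (X1 :&: X2).
by rewrite inE x0X1 x0X2; lia.
Qed.

Lemma Hall_marriage N :
  Hall_condition N -> exists2 f : I -> J, injective f & forall x, f x \in N x.
Proof.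
elim: {N}_.+1 {-2}N (ltnSn (\sum_x #|N x|)) => // c IH N leNc hallN.
have [/existsP[x0 /card_gt1P[y1 [y2 [y1N y2N y12]]]]|] :=
  boolP [exists x, 1 < #|N x|]%N.
  have shrink y : y \in N x0 -> (\sum_x #|delete_edge N x0 y x| < c)%N.
    move=> yN; rewrite -ltnS; apply: leq_trans leNc; rewrite ltnS.
    rewrite (bigD1 x0) //= [X in (_ < X)%N](bigD1 x0) //= -addSn.
    rewrite /delete_edge eqxx [in leqRHS](cardsD1 y) yN leq_add2l.
    by apply: leq_sum => x /negbTE ->.
  have matching y : y \in N x0 -> Hall_condition (delete_edge N x0 y) ->
      exists2 f : I -> J, injective f & forall x, f x \in N x.
    move=> yN hallD; have [f f_inj fN] := IH _ (shrink y yN) hallD.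
    by exists f => // x; have := fN x; rewrite in_delete_edge => /andP[].
  by case/orP: (Hall_delete_edge x0 hallN y12); apply: matching.
rewrite negb_exists => /forallP N_le1.
have N_ex x : exists y, y \in N x.
  apply/set0Pn; rewrite -card_gt0.
  by have /forallP/(_ [set x]) := hallN; rewrite cards1 /neighbours big_set1.
have [f fN] := fin_all_exists N_ex.
exists f => // x x' eq_f; apply/eqP; apply: contraT => neq_x.
have /forallP/(_ [set x; x']) := hallN.
rewrite cards2 neq_x /neighbours bigcup_setU !big_set1.
have N1 z : N z = [set f z].
  by apply/esym/eqP; rewrite eqEcard sub1set fN cards1 leqNgt N_le1.
by rewrite !N1 eq_f setUid cards1.
Qed.

End Hall.

Section Biregular.

Variable T : finType.
Implicit Types (e : rel T) (p : {perm T}) (d : nat).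

Definition biregular e d :=
  (forall i, \sum_j e i j = d)%N /\ (forall j, \sum_i e i j = d)%N.

Lemma biregular_subr e e1 e2 d1 d2 :
    (forall i j, e i j = e1 i j + e2 i j :> nat)%N ->
    biregular e (d1 + d2) -> biregular e1 d1 ->
  biregular e2 d2.
Proof.
move=> eE [e_row e_col] [e1_row e1_col]; split=> [i|j].
  apply: (@addnI d1); rewrite -{1}(e1_row i) -(e_row i) -big_split.
  by apply: eq_bigr.
apply: (@addnI d1); rewrite -{1}(e1_col j) -(e_col j) -big_split.
by apply: eq_bigr => i _; rewrite eE.
Qed.

Lemma biregular_perm p : biregular (fun i j => p i == j) 1.
Proof.
split=> [i|j].
  rewrite (bigD1 (p i)) //= eqxx big1 // => j /negbTE.
  by rewrite eq_sym => ->.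
rewrite (bigD1 (p^-1 j)%g) //= permKV eqxx big1 // => i.
by rewrite -(inj_eq (@perm_inj _ p)) permKV => /negbTE ->.
Qed.

(* Double counting of the edges leaving [X]. *)
Lemma biregular_Hall e d :
  biregular e d.+1 -> Hall_condition (fun i => [set j | e i j]).
Proof.
case=> e_row e_col; apply/forallP => X; set NX := neighbours _ X.
rewrite -(leq_pmul2l (ltn0Sn d)) mulnC [leqRHS]mulnC -!sum_nat_const.
rewrite -(eq_bigr _ (fun i _ => e_row i)) -(eq_bigr _ (fun j _ => e_col j)).
rewrite [leqRHS]exchange_big /= [leqRHS](bigID (mem X)) /=.
apply: leq_trans (leq_addr _ _); apply: leq_sum => i iX.
rewrite (bigID (mem NX)) /= [X in (_ + X)%N]big1 ?addn0 // => j jNX.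
apply/eqP; rewrite eqb0; apply: contra jNX => e_ij.
by apply/bigcupP; exists i; rewrite ?inE.
Qed.

Lemma biregular_sub_perm e d :
  biregular e d.+1 -> exists p : {perm T}, forall i, e i (p i).
Proof.
move=> /biregular_Hall/Hall_marriage[f f_inj fN].
by exists (perm f_inj) => i; rewrite permE; have := fN i; rewrite inE.
Qed.

Lemma biregular_sum_perm e d :
    biregular e d ->
  exists p : nat -> {perm T},
    forall i j, (\sum_(0 <= s < d) (p s i == j) = e i j)%N.
Proof.
elim: d e => [|d IH] e e_reg.
  exists (fun=> 1%g) => i j; rewrite big_geq //.
  have [e_row _] := e_reg; have /eqP := e_row i.
  by rewrite sum_nat_eq0 => /forallP/(_ j)/eqP ->.
have [q qe] := biregular_sub_perm e_reg.
pose e' i j := e i j && (q i != j).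
have eE i j : (e i j = (q i == j) + e' i j :> nat)%N.
  by rewrite /e'; case: eqP => [<-|_]; rewrite ?qe ?andbF ?andbT.
have e'_reg : biregular e' d.
  exact: (biregular_subr (d1 := 1) eE e_reg (biregular_perm q)).
have [p pE] := IH e' e'_reg.
exists (fun s => if s == d then q else p s) => i j.
rewrite big_nat_recr //= eqxx eE addnC -pE; congr addn.
by apply: eq_big_nat => s /andP[_ s_lt_d]; rewrite ltn_eqF.
Qed.

End Biregular.

Lemma alt_sign_telescope (R : nat -> bool) a n :
  let s := [seq (R i.+1)%:Z - (R i)%:Z | i <- iota a n] in
  let nz := [seq x <- s | x != 0] in
  [/\ all (fun x => x \in [:: 0; 1; -1]) s,
      nz = [seq (-1) ^+ (R a + i) | i <- iota 0 (size nz)] &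
      odd (size nz) = R a (+) R (a + n)%N].
Proof.
elim: n a => [|n IH] a /=; first by rewrite addn0 addbb.
have [] := IH a.+1; rewrite addSnnS; set w := map _ _.
move: [seq x <- w | x != 0] => nz w_sign eq_nz odd_nz.
have cons_sign b c : nz = [seq (-1) ^+ (b + i) | i <- iota 0 (size nz)] ->
    (-1) ^+ c = (-1) ^+ b.+1 :> int ->
    (-1) ^+ c :: nz = [seq (-1) ^+ (c + i) | i <- iota 0 (size nz).+1].
  move=> {1}-> ec /=; rewrite addn0 -[1%N]addn0 iotaDl -map_comp; congr cons.
  by apply: eq_map => i /=; rewrite !exprD ec exprS expr1 mulrACA mulrNN !mul1r.
move: eq_nz odd_nz (cons_sign (R a.+1) (R a)).
by case: (R a); case: (R a.+1) => //= eq_nz odd_nz cons_nz;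
  split=> //; rewrite ?odd_nz ?negbK //; apply: (cons_nz eq_nz).
Qed.

Lemma eq_alt_line n (f g : 'I_n -> int) : f =1 g -> alt_line f = alt_line g.
Proof. by move=> fg; congr alt_sign_seq; apply: eq_map. Qed.

Lemma alt_line_psums n (f : nat -> int) :
    (forall p, (p <= n)%N -> 0 <= \sum_(0 <= j < p) f j <= 1) ->
    \sum_(0 <= j < n) f j = 1 ->
  alt_line (fun j : 'I_n => f j).
Proof.
move=> f_psum f_sum; pose R p := \sum_(0 <= j < p) f j == 1.
have fE j : (j < n)%N -> f j = (R j.+1)%:Z - (R j)%:Z.
  move=> jn; have := f_psum _ jn; have := f_psum _ (ltnW jn).
  by rewrite /R big_nat_recr //=; move: (\sum_(0 <= _ < j) _) => S; lia.
rewrite /alt_line /line /alt_sign_seq.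
have -> : [seq f (i : 'I_n) | i <- enum 'I_n] =
          [seq (R i.+1)%:Z - (R i)%:Z | i <- iota 0 n].
  by rewrite -val_enum_ord -map_comp; apply: eq_map => i /=; apply: fE.
have [-> /eqP nzE ->] := alt_sign_telescope R 0 n.
have R0 : R 0 = false by rewrite /R big_geq.
have Rn : R n by rewrite /R f_sum.
by move: nzE; rewrite add0n R0 Rn andbT.
Qed.

Lemma sum_signs n : \sum_(0 <= i < n) (-1) ^+ i = (odd n)%:Z.
Proof.
elim: n => [|n IH]; first by rewrite big_geq.
by rewrite big_nat_recr //= IH -signr_odd; case: odd.
Qed.

Lemma alt_line_sum n (f : 'I_n -> int) : alt_line f -> \sum_j f j = 1.
Proof.
case/and3P=> _ /eqP nzE odd_nz.
have -> : \sum_j f j = \sum_(x <- line f) x by rewrite big_map big_enum.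
rewrite (bigID (fun x => x != 0)) /= addrC big1 ?add0r; last first.
  by move=> x /negPn/eqP.
rewrite -big_filter nzE big_map -[X in iota 0 X]subn0.
by rewrite [LHS]sum_signs odd_nz.
Qed.

Lemma Posz_sum (I : Type) (r : seq I) (P : pred I) (F : I -> nat) :
  (\sum_(i <- r | P i) F i)%N%:Z = \sum_(i <- r | P i) (F i)%:Z.
Proof. exact: (big_morph Posz PoszD (erefl (Posz 0))). Qed.

Lemma sum_delta n q : (\sum_(0 <= j < n) (j == q) = (q < n))%N.
Proof.
elim: n => [|n IH]; first by rewrite big_geq.
by rewrite big_nat_recr //= IH; lia.
Qed.

Lemma sum_itv n a b : (\sum_(0 <= j < n) (a <= j < b) = minn n b - a)%N.
Proof.
elim: n => [|n IH]; first by rewrite big_geq ?min0n.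
by rewrite big_nat_recr //= IH; lia.
Qed.

Lemma alt_line_delta n (i : 'I_n) : alt_line (fun j => (j == i)%:Z).
Proof.
apply: (@alt_line_psums n (fun j => (j == i :> nat)%:Z)) => [p _|].
  by rewrite -Posz_sum sum_delta; case: (_ < _)%N.
by rewrite -Posz_sum sum_delta ltn_ord.
Qed.

Lemma alt_line_perm_row n (g : 'S_n) i : alt_line (fun j => perm_mx g i j).
Proof.
rewrite (eq_alt_line (g := fun j => (j == g i)%:Z)) ?alt_line_delta // => j.
by rewrite !mxE natz eq_sym.
Qed.

Lemma alt_line_perm_col n (g : 'S_n) j : alt_line (fun i => perm_mx g i j).
Proof.
rewrite (eq_alt_line (g := fun i => (i == g^-1%g j)%:Z)) ?alt_line_delta //.
move=> i; rewrite !mxE natz -[in RHS](inj_eq (@perm_inj _ g)).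
by rewrite permKV.
Qed.

Lemma alt_line_nonneg_except m n (f : nat -> int) :
    (m < n)%N -> (forall s, s != m -> 0 <= f s) ->
    \sum_(0 <= s < n) f s = 1 ->
    \sum_(0 <= s < m) f s <= 1 -> \sum_(m.+1 <= s < n) f s <= 1 ->
  alt_line (fun s : 'I_n => f s).
Proof.
move=> mn f_ge0 f_sum f_low f_up.
have f_part a b : (m < a)%N || (b <= m)%N -> 0 <= \sum_(a <= s < b) f s.
  move=> ab_m; rewrite big_nat; apply: sumr_ge0 => s s_ab.
  by apply: f_ge0; lia.
apply: alt_line_psums => // p pn; apply/andP.
have [pm|mp] := leqP p m.
  split; first by rewrite f_part ?pm ?orbT.
  apply: le_trans f_low.
  by rewrite [leRHS](big_cat_nat (leq0n p) pm) lerDl f_part ?leqnn ?orbT.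
move: f_sum; rewrite (big_cat_nat (leq0n p) pn) /= => /(canRL (addrK _)) ->.
rewrite subr_ge0 lerBlDr lerDl f_part ?mp; split=> //.
apply: le_trans f_up.
by rewrite [leRHS](big_cat_nat mp pn) lerDr f_part ?leqnn.
Qed.

Section PermCompletion.

Variables (n m : nat) (A : 'M[int]_n) (U : rel 'I_n).
Hypotheses (lt_m_n : (m < n)%N) (A_ASM : is_ASM A) (U_reg : biregular U m).
Hypothesis AU_01 : forall i j, 0 <= A i j + (U i j)%:Z <= 1.

Let V : rel 'I_n := fun i j => A i j + (U i j)%:Z == 1.

Let VE i j : (V i j)%:Z = A i j + (U i j)%:Z.
Proof. by rewrite /V; have := AU_01 i j; lia. Qed.

Lemma biregular_ASM_add : biregular V m.+1.
Proof.
have [[A_row A_col] [U_row U_col]] := (A_ASM, U_reg).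
have sumE (F G : 'I_n -> bool) (B : 'I_n -> int) :
    (forall i, (F i)%:Z = B i + (G i)%:Z) -> alt_line B ->
    (\sum_i G i = m)%N -> (\sum_i F i = m.+1)%N.
  move=> FE /alt_line_sum B_sum G_sum.
  have: \sum_i (F i)%:Z = \sum_i (B i + (G i)%:Z) by apply: eq_bigr => i _.
  by rewrite big_split /= B_sum -!Posz_sum G_sum -PoszD add1n => -[].
split=> [i|j].
  exact: sumE (VE i) (A_row i) (U_row i).
exact: sumE (VE^~ j) (A_col j) (U_col j).
Qed.

Lemma biregular_compl_ASM_add : biregular (fun i j => ~~ V i j) (n - m.+1).
Proof.
apply: (biregular_subr (e := fun _ _ => true) _ _ biregular_ASM_add).
  by move=> i j; case: (V i j).
by rewrite subnKC //; split=> ?; rewrite sum1_card card_ord.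
Qed.

Definition stack_around (p q : nat -> 'S_n) (s : nat) : 'S_n :=
  if (s < m)%N then p s else q (s - m.+1)%N.

Lemma alt_line_stack_around (p q : nat -> 'S_n) i j :
    (\sum_(0 <= s < m) (p s i == j) = U i j)%N ->
    (\sum_(0 <= s < n - m.+1) (q s i == j) = ~~ V i j)%N ->
  alt_line (fun s : 'I_n =>
    (if s == m :> nat then A else perm_mx (stack_around p q s)) i j).
Proof.
move=> pU qV.
pose f s : int := if s == m then A i j else (stack_around p q s i == j)%:Z.
rewrite (eq_alt_line (g := fun s => f s)); last first.
  by move=> s; rewrite /f; case: ifP; rewrite ?mxE ?natz.
have f_low : \sum_(0 <= s < m) f s = (U i j)%:Z.
  rewrite -pU Posz_sum; apply: eq_big_nat => s /andP[_ sm].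
  by rewrite /f /stack_around sm ltn_eqF.
have f_up : \sum_(m.+1 <= s < n) f s = (~~ V i j)%:Z.
  rewrite -qV Posz_sum -{1}[m.+1]add0n big_addn.
  apply: eq_big_nat => s _; rewrite /f /stack_around addnK addnS.
  by rewrite gtn_eqF ?ltnS ?leq_addl // ltnNge ltnW ?ltnS ?leq_addl.
apply: (alt_line_nonneg_except lt_m_n) => [s /negbTE sm|||].
- by rewrite /f sm.
- rewrite (big_cat_nat (leq0n m) (ltnW lt_m_n)) /= [X in _ + X]big_ltn //.
  by rewrite f_low f_up /f eqxx; have := VE i j; case: (V i j) => /=; lia.
- by rewrite f_low; case: (U i j).
- by rewrite f_up; case: (V i j).
Qed.

Lemma ASHM_perm_completion :
  exists P : 'I_n -> 'M[int]_n,
    (forall s : 'I_n, s != m :> nat -> is_perm_mx (P s)) /\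
    is_ASHM (fun s : 'I_n => if s == m :> nat then A else P s).
Proof.
have [p pU] := biregular_sum_perm U_reg.
have [q qV] := biregular_sum_perm biregular_compl_ASM_add.
exists (fun s => perm_mx (stack_around p q s)).
split=> [s _|]; first exact: perm_mx_is_perm.
have [A_row A_col] := A_ASM; split=> [i j|]; first exact: alt_line_stack_around.
split=> s i; case: eqP => _; rewrite ?A_row ?A_col //.
  exact: alt_line_perm_row.
exact: alt_line_perm_col.
Qed.

End PermCompletion.

(* The lower bound makes the partial sums constantly 1 from [n] on, so that [f]
   vanishes there. *)
Definition alternating n (f : nat -> int) :=
  forall p, (n <= p)%N%:Z <= \sum_(0 <= j < p) f j <= 1.

Lemma alternating_alt_line n (f : nat -> int) :
  alternating n f -> alt_line (fun j : 'I_n => f j).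
Proof.
move=> f_alt; apply: alt_line_psums => [p _|].
  by case/andP: (f_alt p) => f_ge ->; rewrite (le_trans _ f_ge).
by apply/eqP; have := f_alt n; rewrite leqnn eq_le andbC.
Qed.

Lemma eq_alternating n f g : f =1 g -> alternating n f -> alternating n g.
Proof. by move=> fg f_alt p; rewrite -(eq_bigr _ (fun j _ => fg j)). Qed.

Lemma alternating_widen n n' f :
  (n <= n')%N -> alternating n f -> alternating n' f.
Proof.
by move=> le_n f_alt p; have /andP[f_ge ->] := f_alt p; rewrite andbT; lia.
Qed.

Lemma alternating_narrow n p f :
  (forall j, (p <= j)%N -> f j = 0) -> alternating n f -> alternating p f.
Proof.
move=> f0 f_alt x; have [px|xp] := leqP p x; last first.
  by have := f_alt x; lia.
have f_tail : \sum_(0 <= j < maxn x n) f j = \sum_(0 <= j < x) f j.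
  rewrite (big_cat_nat (leq0n x) (leq_maxl x n)) /= [X in _ + X]big_nat.
  rewrite [X in _ + X]big1 ?addr0 // => j /andP[xj _].
  by rewrite f0 // (leq_trans px).
by have := f_alt (maxn x n); rewrite f_tail leq_maxr.
Qed.

Lemma alternating_delta q : alternating q.+1 (fun j => (j == q)%:Z).
Proof. by move=> p; rewrite -Posz_sum sum_delta; case: (q < p)%N. Qed.

Lemma alternating_append p q f :
    (p < q)%N -> alternating p f ->
  alternating q.+1 (fun j => f j - (j == p)%:Z + (j == q)%:Z).
Proof.
move=> pq f_alt x; rewrite big_split sumrB /= -!Posz_sum !sum_delta.
by have := f_alt x; move: (\sum_(0 <= _ < x) f _) => S; lia.
Qed.

Record stackable n m (A : nat -> nat -> int) (U : nat -> nat -> bool) : Prop :=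
{
  stackable_row : forall i, (i < n)%N -> alternating n (A i);
  stackable_col : forall j, (j < n)%N -> alternating n (A^~ j);
  stackable_reg : biregular (fun i j : 'I_n => U i j) m;
  stackable_01 : forall i j, 0 <= A i j + (U i j)%:Z <= 1
}.

Definition as_matrix n (A : nat -> nat -> int) : 'M[int]_n :=
  \matrix_(i, j) A i j.

Lemma stackable_ASM n m A U : stackable n m A U -> is_ASM (as_matrix n A).
Proof.
case=> A_row A_col _ _; split=> [i|j].
  rewrite (eq_alt_line (g := fun j => A i j)) => [|j]; last by rewrite mxE.
  exact/alternating_alt_line/A_row.
rewrite (eq_alt_line (g := fun i => A i j)) => [|i]; last by rewrite mxE.
exact/(alternating_alt_line (f := A^~ j))/A_col.
Qed.

Lemma num_neg_as_matrix n A :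
  num_neg (as_matrix n A) =
  (\sum_(0 <= i < n) \sum_(0 <= j < n) (A i j == -1)%R)%N.
Proof.
rewrite big_mkord; under [RHS]eq_bigr => i _ do rewrite big_mkord.
rewrite /num_neg pair_bigA /= -sum1_card big_mkcond.
by apply: eq_bigr => ij _; rewrite inE mxE; case: eqP.
Qed.

Definition confined T (z : T) n m (F : nat -> nat -> T) :=
  forall i j, ~~ [&& i < n, j < n & i + j < n + m]%N -> F i j = z.

Definition frame n m i j : bool :=
  [|| [&& i < n, j < n & i + j == n + m], (i == n) && (j <= m)
    | (j == n) && (i <= m)]%N.

Definition zigzag_neg n m r i j : bool :=
  ((i + j == n + m) && (m < j <= m + r))%N.

(* Each -1 at [(i, j)] is followed by a +1 at [(i.+1, j)] and by a +1 at
   [(i, j.+1)], except that in the topmost row [n - r] the latter is moved to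
   the new column [n]. *)
Definition zigzag_pos n m r i j : bool :=
  ((i + j == (n + m).+1) && (m < j <= m + r) || (i + r == n) && (j == n))%N.

Definition corner_ext_ASM n m r (A : nat -> nat -> int) i j : int :=
  A i j - (zigzag_neg n m r i j)%:Z + (zigzag_pos n m r i j)%:Z.

Definition corner_ext_low n m (U : nat -> nat -> bool) i j : bool :=
  U i j || frame n m i j.

Lemma frameC n m i j : frame n m i j = frame n m j i.
Proof. by rewrite /frame; lia. Qed.

Lemma frame_sum n m i : (m < n)%N -> (i <= n)%N ->
  (\sum_(0 <= j < n.+1) frame n m i j = if i == n then m.+1 else 1)%N.
Proof.
move=> lt_mn le_in; case: eqP => [->|/eqP ne_in].
  rewrite -[RHS]subn0 -(minn_idPr (leqW lt_mn)) -sum_itv.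
  by apply: eq_big_nat => j; rewrite /frame; lia.
transitivity (minn n (n + m - i) < n.+1)%N; last by rewrite ltnS geq_minl.
by rewrite -sum_delta; apply: eq_big_nat => j; rewrite /frame; lia.
Qed.

Lemma corner_ext_low_sum n m U (i : 'I_n.+1) :
    (m < n)%N -> confined false n m U ->
    (forall i : 'I_n, \sum_(j < n) U i j = m)%N ->
  (\sum_(j < n.+1) corner_ext_low n m U i j = m.+1)%N.
Proof.
move=> lt_mn U_conf U_sum.
rewrite (eq_bigr (fun j : 'I_n.+1 => U i j + frame n m i j)%N); last first.
  move=> j _; rewrite /corner_ext_low.
  have [inside|outside] := boolP [&& i < n, j < n & i + j < n + m]%N.
    by rewrite /frame; case: (U i j); lia.
  by rewrite U_conf.
rewrite big_split /= -(big_mkord xpredT (fun j => frame n m i j : nat)).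
rewrite frame_sum -1?ltnS // big_ord_recr /=.
rewrite U_conf ?ltnn ?andbF // addn0.
case: eqP => [->|/eqP ne_in].
  by rewrite big1 // => j _; rewrite U_conf ?ltnn.
have lt_in : (i < n)%N by rewrite ltn_neqAle ne_in -ltnS ltn_ord.
by rewrite (U_sum (Ordinal lt_in)) addn1.
Qed.

Lemma corner_ext_low_biregular n m U :
    (m < n)%N -> confined false n m U ->
    biregular (fun i j : 'I_n => U i j) m ->
  biregular (fun i j : 'I_n.+1 => corner_ext_low n m U i j) m.+1.
Proof.
move=> lt_mn U_conf [U_row U_col]; split=> [i|j].
  exact: corner_ext_low_sum lt_mn U_conf U_row.
rewrite -[RHS](corner_ext_low_sum (U := fun j i => U i j) j lt_mn _ U_col).
  by apply: eq_bigr => i _; rewrite /corner_ext_low frameC.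
by move=> a b out; apply: U_conf; lia.
Qed.

Lemma corner_ext_low_confined n m U : (m < n)%N ->
  confined false n m U -> confined false n.+1 m.+1 (corner_ext_low n m U).
Proof.
move=> lt_mn U_conf i j out.
by rewrite /corner_ext_low U_conf /frame; lia.
Qed.

Section CornerExtension.

Variables (n m r : nat) (A : nat -> nat -> int) (U : nat -> nat -> bool).
Hypotheses (mr_lt_n : (m + r < n)%N) (A_U : stackable n m A U)
  (A_conf : confined 0 n m A) (U_conf : confined false n m U).

Lemma corner_ext_row i :
  (i < n.+1)%N -> alternating n.+1 (corner_ext_ASM n m r A i).
Proof.
rewrite ltnS leq_eqVlt => /orP[/eqP ->|lt_i].
  pose q := if r == 0%N then n else m.+1.
  apply: (eq_alternating (f := fun j => (j == q)%:Z)) => [j|].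
    rewrite /corner_ext_ASM A_conf; last lia.
    by rewrite /zigzag_neg /zigzag_pos /q; case: ifP; lia.
  by apply: alternating_widen (alternating_delta q); rewrite /q; case: ifP; lia.
have [far|near] := ltnP (i + r) n.
  apply: alternating_widen (leqnSn n) _.
  apply: (eq_alternating (f := A i)) (stackable_row A_U lt_i) => j.
  by rewrite /corner_ext_ASM /zigzag_neg /zigzag_pos; lia.
pose p := (n + m - i)%N; pose q := if (i + r == n)%N then n else p.+1.
apply: (eq_alternating
  (f := fun j => A i j - (j == p)%:Z + (j == q)%:Z)) => [j|].
  by rewrite /corner_ext_ASM /zigzag_neg /zigzag_pos /q /p; case: ifP; lia.
have pq : (p < q)%N by rewrite /p /q; case: ifP; lia.
apply: alternating_widen (alternating_append pq _).
  by rewrite /q /p; case: ifP; lia.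
apply: alternating_narrow (stackable_row A_U lt_i) => j pj.
by rewrite A_conf //; rewrite /p in pj; lia.
Qed.

Lemma corner_ext_col j :
  (j < n.+1)%N -> alternating n.+1 (corner_ext_ASM n m r A ^~ j).
Proof.
rewrite ltnS leq_eqVlt => /orP[/eqP ->|lt_j].
  apply: (eq_alternating (f := fun i => (i == n - r)%N%:Z)) => [i|].
    rewrite /corner_ext_ASM A_conf; last lia.
    by rewrite /zigzag_neg /zigzag_pos; lia.
  by apply: alternating_widen (alternating_delta _); lia.
have [/andP[mj jr]|out] := boolP (m < j <= m + r)%N; last first.
  apply: alternating_widen (leqnSn n) _.
  apply: (eq_alternating (f := A^~ j)) (stackable_col A_U lt_j) => i.
  by rewrite /corner_ext_ASM /zigzag_neg /zigzag_pos; lia.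
pose p := (n + m - j)%N.
apply: (eq_alternating
  (f := fun i => A i j - (i == p)%:Z + (i == p.+1)%:Z)) => [i|].
  by rewrite /corner_ext_ASM /zigzag_neg /zigzag_pos /p; lia.
apply: alternating_widen (alternating_append (ltnSn p) _).
  by rewrite /p; lia.
apply: alternating_narrow (stackable_col A_U lt_j) => i pi.
by rewrite A_conf //; rewrite /p in pi; lia.
Qed.

Lemma corner_ext_01 i j :
  0 <= corner_ext_ASM n m r A i j + (corner_ext_low n m U i j)%:Z <= 1.
Proof.
rewrite /corner_ext_ASM /corner_ext_low /zigzag_neg /zigzag_pos /frame.
have [inside|outside] := boolP [&& i < n, j < n & i + j < n + m]%N.
  by have := stackable_01 A_U i j; case: (U i j); lia.
by rewrite A_conf // U_conf //=; lia.
Qed.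

Lemma num_neg_confined :
  num_neg (as_matrix n.+1 A) = num_neg (as_matrix n A).
Proof.
rewrite !num_neg_as_matrix big_nat_recr //= [X in (_ + X)%N]big1 ?addn0.
  apply: eq_bigr => i _.
  by rewrite big_nat_recr //= [X in (X == _)%R]A_conf ?ltnn ?andbF ?addn0.
by move=> j _; rewrite A_conf ?ltnn.
Qed.

Lemma zigzag_neg_sum :
  (\sum_(0 <= i < n.+1) \sum_(0 <= j < n.+1) zigzag_neg n m r i j = r)%N.
Proof.
rewrite exchange_big /= -[RHS](addKn m.+1) addSn.
rewrite -(minn_idPr (leqW mr_lt_n)) -sum_itv.
apply: eq_big_nat => j le_jn.
have [in_zigzag|out] := boolP (m < j < (m + r).+1)%N; last first.
  by apply: big1 => i _; rewrite /zigzag_neg; lia.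
transitivity (n + m - j < n.+1)%N; last by lia.
by rewrite -sum_delta; apply: eq_big_nat => i; rewrite /zigzag_neg; lia.
Qed.

Lemma corner_ext_num_neg :
  num_neg (as_matrix n.+1 (corner_ext_ASM n m r A)) =
  (num_neg (as_matrix n A) + r)%N.
Proof.
rewrite -num_neg_confined -[in RHS]zigzag_neg_sum !num_neg_as_matrix -big_split.
apply: eq_bigr => i _; rewrite -big_split; apply: eq_bigr => j _ /=.
rewrite /corner_ext_ASM /zigzag_neg /zigzag_pos.
have [inside|outside] := boolP [&& i < n, j < n & i + j < n + m]%N; first lia.
by rewrite A_conf //; lia.
Qed.

Lemma corner_ext_stackable :
  stackable n.+1 m.+1 (corner_ext_ASM n m r A) (corner_ext_low n m U).
Proof.
split=> [i lt_in|j lt_jn||i j].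
- exact: corner_ext_row.
- exact: corner_ext_col.
- apply: corner_ext_low_biregular U_conf (stackable_reg A_U).
  exact: leq_ltn_trans (leq_addr r m) mr_lt_n.
- exact: corner_ext_01.
Qed.

End CornerExtension.

(* With [m + r + 1 = n] the [+1] in the last column lies on the antidiagonal
   [i + j = n + m + 1]. *)
Lemma corner_ext_ASM_confined n m r A : (m + r).+1 = n ->
  confined 0 n m A -> confined 0 n.+1 m.+1 (corner_ext_ASM n m r A).
Proof.
move=> nE A_conf i j out.
by rewrite /corner_ext_ASM A_conf /zigzag_neg /zigzag_pos; lia.
Qed.

Definition antidiag n i j : int := ((i + j).+1 == n)%N%:Z.

(* For [m <= n] the last condition says that [(i + j) %% n < m]. *)
Definition circulant_low n m i j : bool :=
  [&& i < n, j < n & (i + j < m) || (n <= i + j < n + m)]%N.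

Lemma circulant_low_sum n m i : (m < n)%N -> (i < n)%N ->
  (\sum_(0 <= j < n) circulant_low n m i j = m)%N.
Proof.
move=> lt_mn lt_in.
rewrite (eq_big_nat _ _ (F2 := fun j =>
  (0 <= j < m - i) + (n - i <= j < n + m - i))%N).
  by rewrite big_split !sum_itv /=; lia.
by move=> j; rewrite /circulant_low; lia.
Qed.

Lemma stackable_antidiag n m :
  (m < n)%N -> stackable n m (antidiag n) (circulant_low n m).
Proof.
move=> lt_mn.
have antidiag_alt i : (i < n)%N -> alternating n (antidiag n i).
  move=> lt_in; apply: (alternating_widen (n := (n - i.+1).+1)); first lia.
  by apply: eq_alternating (alternating_delta _) => j; rewrite /antidiag; lia.
split=> [//|j lt_jn||i j].
- by apply: eq_alternating (antidiag_alt j lt_jn) => i; rewrite /antidiag addnC.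
- split=> i; rewrite -[RHS](circulant_low_sum lt_mn (ltn_ord i)) big_mkord //.
  by apply: eq_bigr => j _; rewrite /circulant_low; lia.
- by rewrite /antidiag /circulant_low; lia.
Qed.

Lemma num_neg_antidiag n : num_neg (as_matrix n (antidiag n)) = 0%N.
Proof. by rewrite num_neg_as_matrix big1 // => i _; rewrite big1. Qed.

Lemma confined_stackable_exists n m q : (m < n)%N ->
  exists A U, [/\ stackable (n + q) (m + q) A U,
    confined 0 (n + q) (m + q) A, confined false (n + q) (m + q) U &
    num_neg (as_matrix (n + q) A) = (q * (n - m.+1))%N].
Proof.
move=> lt_mn; elim: q => [|q [A [U [A_U A_conf U_conf A_neg]]]].
  rewrite !addn0; exists (antidiag n), (circulant_low n m); split.
  - exact: stackable_antidiag.
  - by move=> i j; rewrite /antidiag; lia.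
  - by move=> i j; rewrite /circulant_low; lia.
  - exact: num_neg_antidiag.
set l := (n - m.+1)%N; have nE : (m + q + l).+1 = (n + q)%N by rewrite /l; lia.
have mql_lt : (m + q + l < n + q)%N by rewrite -nE.
rewrite !addnS; exists (corner_ext_ASM (n + q) (m + q) l A).
exists (corner_ext_low (n + q) (m + q) U); split.
- exact: corner_ext_stackable A_U A_conf U_conf.
- exact: corner_ext_ASM_confined.
- by apply: corner_ext_low_confined; rewrite ?ltn_add2r.
- by rewrite corner_ext_num_neg // A_neg mulSn addnC.
Qed.

Lemma leq_mul_decomp m l t : (t <= m.+1 * l)%N ->
  exists q r, [/\ q <= m, r <= l & t = q * l + r]%N.
Proof.
elim: m t => [|m IH] t le_t; first by exists 0%N, t; rewrite mul1n in le_t.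
have [le_tl|lt_lt] := leqP t l; first by exists 0%N, t.
have [|q [r [le_qm le_rl tE]]] := IH (t - l)%N.
  by rewrite mulSn in le_t; lia.
by exists q.+1, r; split=> //; rewrite mulSn; lia.
Qed.

Lemma stackable_exists n m t : (m < n)%N -> (t <= m * (n - m.+1))%N ->
  exists A U, stackable n m A U /\ num_neg (as_matrix n A) = t.
Proof.
case: m => [|m] lt_mn le_t.
  exists (antidiag n), (circulant_low n 0).
  by split; [apply: stackable_antidiag | rewrite num_neg_antidiag; lia].
case: n lt_mn le_t => // n lt_mn; rewrite subSS => /leq_mul_decomp.
case=> q [r [le_qm le_r ->]].
have [|A [U]] := @confined_stackable_exists (n - q) (m - q) q; first lia.
rewrite !subnK //; last lia.
case=> A_U A_conf U_conf A_neg.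
have mr_lt : (m + r < n)%N by lia.
exists (corner_ext_ASM n m r A), (corner_ext_low n m U).
split; first exact: corner_ext_stackable.
by rewrite corner_ext_num_neg // A_neg; congr (_ * _ + _)%N; lia.
Qed.

(* Planes are indexed by s : 'I_n, with s.+1 the paper's 1-based index. *)
Theorem mainTheorem13 (n k t : nat) :
  (1 <= k)%N -> (k <= n)%N -> (t <= (k - 1) * (n - k))%N ->
  exists (A : 'M[int]_n) (P : 'I_n -> 'M[int]_n),
    [/\ is_ASM A, num_neg A = t,
        (forall s : 'I_n, s.+1 != k -> is_perm_mx (P s)) &
        is_ASHM (fun s : 'I_n => if s.+1 == k then A else P s)].
Proof.
case: k => // m _ lt_mn; rewrite subn1.
move=> /(stackable_exists lt_mn)[A [U [A_U A_neg]]].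
have A_ASM := stackable_ASM A_U.
have [i j|P [P_perm AP_ASHM]] :=
  ASHM_perm_completion lt_mn A_ASM (stackable_reg A_U).
  by rewrite mxE; apply: stackable_01 A_U i j.
by exists (as_matrix n A), P.
Qed.
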